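(* Let $\mathcal{B}$ be a left-sided reproducing kernel Banach space of functions on $\Omega$ with left-sided reproducing kernel $K\in L_0(\Omega\times\Omega')$. If the domain $\Omega'$ of the functions in the dual space $\mathcal{B}'$ contains a countable subset $X'\subseteq\Omega'$ such that for any $g\in\mathcal{B}'$, $g|_{X'}=0$ if and only if $g=0$, then $\mathcal{B}$ is separable.
   Context: $\Omega,\Omega'$ are locally compact Hausdorff spaces equipped with regular Borel measures $\mu,\mu'$. $L_0(X)$ denotes the set of real-valued measurable functions on $X$ (genuine functions). For a Banach space $\mathcal{B}$, $\mathcal{B}'$ is its continuous dual and $\langle f,G\rangle_{\mathcal{B}}:=G(f)$. Left-sided reproducing kernel Banach space: let $K\in L_0(\Omega\times\Omega')$ and let $\mathcal{B}$ be a Banach space consisting of functions in $L_0(\Omega)$ whose dual $\mathcal{B}'$ is isometrically isomorphic to a normed space $\mathcal{F}$ consisting of functions in $L_0(\Omega')$; $\mathcal{F}$ is fixed and identified with $\mathcal{B}'$ (so elements of $\mathcal{B}'$ are functions on $\Omega'$). $\mathcal{B}$ is a left-sided reproducing kernel Banach space with left-sided reproducing kernel $K$ if $K(\cdot,y)\in\mathcal{B}$ for each $y\in\Omega'$, and $\langle K(\cdot,y),g\rangle_{\mathcal{B}}=g(y)$ for all $g\in\mathcal{F}\cong\mathcal{B}'$ and all $y\in\Omega'$. *)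

(* Defs.v *)
From HB Require Import structures.
From mathcomp Require Import all_boot all_order all_algebra.
From mathcomp Require Import all_classical all_reals all_analysis.

Set Implicit Arguments.
Unset Strict Implicit.
Unset Printing Implicit Defensive.

Import Order.TTheory GRing.Theory Num.Theory.
Import numFieldNormedType.Exports.

Local Open Scope classical_set_scope.
Local Open Scope ring_scope.

(* The library has both structures on products but not their join. *)
HB.instance Definition _ (T U : ptopologicalType) := Pointed.on (T * U)%type.

Definition borel (T : ptopologicalType) := g_sigma_algebraType (@open T).

(* Regularity in the usual sense for locally compact Hausdorff spaces: inner
   regularity is only required on open sets, which is the weaker convention. *)
Definition regular_borel_measure (R : realType) (T : ptopologicalType)
    (mu : {measure set (borel T) -> \bar R}) : Prop :=
  [/\ forall C : set T, compact C -> (mu C < +oo)%E,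
      forall A : set (borel T), measurable A ->
        mu A = ereal_inf [set mu U | U in [set U : set T | open U /\ A `<=` U]]
    & forall U : set T, open U ->
        mu U = ereal_sup [set mu C | C in [set C : set T | compact C /\ C `<=` U]]].

(* Genuine functions: no identification of almost everywhere equal functions.
   [L0 R T] does not depend on the measure on [T]. *)
Definition L0 (R : realType) (T : ptopologicalType) : set (T -> R) :=
  [set f | measurable_fun [set: borel T] (f : borel T -> R)].
Arguments L0 : clear implicits.

(* The normed space [V] consists of functions in [L0 R T]: [ev v] is the
   function that [v] is, so the vector space operations of [V] are the pointwise
   ones and an element of [V] is determined by its values. *)
Definition function_space (R : realType) (T : ptopologicalType)
    (V : normedModType R) (ev : V -> T -> R) : Prop :=
  [/\ linear (ev : V -> T -> R^o), injective ev
    & forall v, L0 R T (ev v)].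

Definition continuous_dual (R : realType) (B : normedModType R) : set (B -> R) :=
  [set G | linear (G : B -> R^o) /\ continuous G].
Arguments continuous_dual {R} B.

Definition dual_norm (R : realType) (B : normedModType R) (G : B -> R) : R :=
  sup [set `|G f| | f in [set f : B | `|f| <= 1]].

Definition dual_isometry (R : realType) (B F : normedModType R)
    (phi : F -> B -> R) : Prop :=
  [/\ linear (phi : F -> B -> R^o), set_bij [set: F] (continuous_dual B) phi
    & forall g : F, dual_norm (phi g) = `|g|].

(* [phi] is the fixed identification of [F] with the dual of [B], so that the
   pairing of [f : B] with [g : F] is [phi g f]. The kernel is measurable for
   the Borel sigma-algebra of the product topology. *)
Record left_rkbs (R : realType) (T T' : ptopologicalType)
    (K : T * T' -> R)
    (B : completeNormedModType R) (evB : B -> T -> R)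
    (F : normedModType R) (evF : F -> T' -> R)
    (phi : F -> B -> R) : Prop := LeftRKBS {
  rkbs_kernel : L0 R (T * T')%type K ;
  rkbs_space : function_space evB ;
  rkbs_dual_space : function_space evF ;
  rkbs_dual : dual_isometry phi ;
  rkbs_mem : forall y : T', range evB (fun x => K (x, y)) ;
  rkbs_reproducing : forall (y : T') (k : B), evB k = (fun x => K (x, y)) ->
    forall g : F, phi g k = evF g y
}.

Definition separable (T : topologicalType) : Prop :=
  exists D : set T, countable D /\ dense D.

(* Main.v *)
Require Import Defs.
From HB Require Import structures.
From mathcomp Require Import all_boot all_order all_algebra.
From mathcomp Require Import all_classical all_reals all_analysis.
From mathcomp Require Import lra.

Set Implicit Arguments.
Unset Strict Implicit.
Unset Printing Implicit Defensive.

Import Order.TTheory GRing.Theory Num.Theory.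
Import numFieldNormedType.Exports.

Local Open Scope classical_set_scope.
Local Open Scope ring_scope.

(* The functions K(., y), y in X', form a countable subset of B, so their
   rational span is countable. If it were not dense, Hahn-Banach would give a
   nonzero element of the dual vanishing on all K(., y), that is, some g <> 0
   with g(y) = <K(., y), g> = 0 on X'.

   Hahn-Banach is obtained from minimal sublinear functionals: by Zorn every
   sublinear p dominates a minimal one, and minimal ones are linear because
   y |-> inf_(t >= 0) (p (y + t x) - t p x) is again sublinear and below p. *)

(** * Sublinear functionals and the Hahn-Banach theorem *)

Definition sublinear (R : realType) (V : lmodType R) (p : V -> R) : Prop :=
  (forall x y, p (x + y) <= p x + p y) /\
  (forall a x, 0 <= a -> p (a *: x) <= a * p x).

Lemma sublinear0 (R : realType) (V : lmodType R) (p : V -> R) :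
  sublinear p -> p 0 = 0.
Proof.
move=> [pD pZ]; have := pD 0 0; have := pZ 0 0 (lexx 0).
by rewrite scale0r addr0; lra.
Qed.

Lemma sublinear_ge (R : realType) (V : lmodType R) (p : V -> R) (x : V) :
  sublinear p -> - p (- x) <= p x.
Proof.
move=> sp; have [pD _] := sp; have := pD x (- x).
by rewrite subrr (sublinear0 sp); lra.
Qed.

Lemma sublinear_scale (R : realType) (V : lmodType R) (p : V -> R) (a : R)
    (x : V) : sublinear p -> 0 <= a -> p (a *: x) = a * p x.
Proof.
move=> sp; have [_ pZ] := sp.
rewrite le_eqVlt => /predU1P[<-|a0].
  by rewrite scale0r mul0r sublinear0.
apply/eqP; rewrite eq_le (pZ _ _ (ltW a0))/=.
(* The reverse inequality is the bound [p (b *: z) <= b * p z] at b = a^-1, z = a x. *)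
rewrite mulrC -ler_pdivlMr// mulrC.
have := pZ a^-1 (a *: x); rewrite invr_ge0 ltW// => /(_ isT).
by rewrite scalerA mulVf ?scale1r// gt_eqF.
Qed.

(** The single [F i] need not be sublinear: it is enough that some member of the family absorbs each
    sum and each nonnegative multiple. This serves chains of functionals, shifts and distances to a
    subspace alike. *)
Lemma sublinear_inf (R : realType) (V : lmodType R) (I : Type) (D : set I)
    (F : I -> V -> R) :
  D !=set0 ->
  (forall x, has_lbound [set F i x | i in D]) ->
  (forall i j x y, D i -> D j ->
    exists2 k, D k & F k (x + y) <= F i x + F j y) ->
  (forall i a x, 0 <= a -> D i -> exists2 j, D j & F j (a *: x) <= a * F i x) ->
  sublinear (fun x => inf [set F i x | i in D]).
Proof.
move=> [i0 Di0] lbF FD FZ.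
have inf_le i x : D i -> inf [set F i x | i in D] <= F i x.
  by move=> Di; apply: ge_inf => //; exists i.
have le_inf x r : (forall i, D i -> r <= F i x) -> r <= inf [set F i x | i in D].
  move=> rF; apply: lb_le_inf; first by exists (F i0 x), i0.
  by move=> _ [i Di <-]; exact: rF.
split=> [x y|a x].
- rewrite -lerBlDr; apply/le_inf => i Di.
  rewrite lerBlDr -lerBlDl; apply/le_inf => j Dj.
  rewrite lerBlDl; have [k Dk] := FD i j x y Di Dj.
  by apply: le_trans; exact: inf_le.
- rewrite le_eqVlt => /predU1P[<-|a0].
    rewrite mul0r; have [j Dj] := FZ i0 0 x (lexx 0) Di0.
    by rewrite mul0r; apply: le_trans; exact: inf_le.
  rewrite mulrC -ler_pdivrMr//; apply/le_inf => i Di.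
  rewrite ler_pdivrMr// mulrC; have [j Dj] := FZ i a x (ltW a0) Di.
  by apply: le_trans; exact: inf_le.
Qed.

Definition minimal_sublinear (R : realType) (V : lmodType R) (p : V -> R) :=
  sublinear p /\
  forall q, sublinear q -> (forall x, q x <= p x) -> forall x, p x <= q x.

Lemma exists_minimal_sublinear (R : realType) (V : lmodType R) (p : V -> R) :
  sublinear p ->
  exists2 q, minimal_sublinear q & forall x, q x <= p x.
Proof.
move=> sp.
pose P q := sublinear q /\ forall x, q x <= p x.
pose T := {q : V -> R | P q}.
(* The order is reversed, so that a maximal element in Zorn's lemma is a minimal functional. *)
pose ord (s t : T) := `[< forall x, sval t x <= sval s x >].
have [||||[q [sq qp]] qmax] := @Zorn T ord.
- by move=> t; apply/asboolP.
- move=> r s t /asboolP rs /asboolP st; apply/asboolP => x.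
  exact: le_trans (st x) (rs x).
- move=> [s ?] [t ?] /asboolP/= st /asboolP/= ts; apply: eq_exist.
  by apply/funext => x; apply/le_anti; rewrite st ts.
- move=> A Atot; have [->|/set0P[t0 At0]] := eqVneq A set0.
    by exists (exist P p (conj sp (fun x => lexx (p x)))).
  (* A nonempty chain is bounded by its pointwise infimum, which is finite because -p(-x) <= -q(-x)
     <= q(x) whenever q <= p is sublinear. *)
  have lbA x : has_lbound [set sval t x | t in A].
    exists (- p (- x)) => _ [[q [sq qp]] _ <-] /=.
    by apply: le_trans (sublinear_ge x sq); rewrite lerN2.
  have si : sublinear (fun x => inf [set sval t x | t in A]).
    apply: sublinear_inf => //; first by exists t0.
    (* Of two members of the chain, the smaller one absorbs the sum. *)
    - move=> s t x y As At; have [/asboolP st|/asboolP ts] := Atot _ _ As At.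
      + exists t => //; have [[+ _] _] := svalP t => /(_ x y) /le_trans; apply.
        by rewrite lerD2r.
      + exists s => //; have [[+ _] _] := svalP s => /(_ x y) /le_trans; apply.
        by rewrite lerD2l.
    - by move=> t a x a0 At; exists t => //; have [[_ +] _] := svalP t; apply.
  have ile t x : A t -> inf [set sval t x | t in A] <= sval t x.
    by move=> At; apply: ge_inf => //; exists t.
  have ip x : inf [set sval t x | t in A] <= p x.
    by apply: le_trans (ile _ x At0) _; have [_] := svalP t0; apply.
  exists (exist P _ (conj si ip)) => s As; apply/asboolP => x /=.
  exact: ile.
- exists q => //; split=> // r sr rq x.
  have rp y : r y <= p y by exact: le_trans (rq y) (qp y).
  have := qmax (exist P r (conj sr rp)).
  have /[swap]/[apply]/(congr1 sval)/= -> // : ord (exist P q (conj sq qp))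
    (exist P r (conj sr rp)) by exact/asboolP.
Qed.

Definition shift_sublinear (R : realType) (V : lmodType R) (p : V -> R)
    (x y : V) : R :=
  inf [set p (y + t *: x) - t * p x | t in [set t | 0 <= t]].

Lemma shift_sublinear_le (R : realType) (V : lmodType R) (p : V -> R)
    (x y : V) (t : R) :
  sublinear p -> 0 <= t -> shift_sublinear p x y <= p (y + t *: x) - t * p x.
Proof.
move=> sp t0; apply: ge_inf; last by exists t.
(* The lower bound comes from s p(x) = p(s x) <= p(y + s x) + p(-y). *)
exists (- p (- y)) => _ [s /= s0 <-].
have [pD _] := sp; have := pD (y + s *: x) (- y).
by rewrite addrAC subrr add0r (sublinear_scale _ sp)//; lra.
Qed.

Lemma sublinear_shift (R : realType) (V : lmodType R) (p : V -> R) (x : V) :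
  sublinear p -> sublinear (shift_sublinear p x).
Proof.
move=> sp; have [pD pZ] := sp; apply: sublinear_inf.
- by exists 0 => /=.
- move=> y; exists (- p (- y)) => _ [s /= s0 <-].
  have := pD (y + s *: x) (- y).
  by rewrite addrAC subrr add0r (sublinear_scale _ sp)//; lra.
- move=> s t y z /= s0 t0; exists (s + t); first exact: addr_ge0.
  have := pD (y + s *: x) (z + t *: x).
  by rewrite addrACA -scalerDl mulrDl; lra.
- move=> t a y a0 /= t0; exists (a * t); first exact: mulr_ge0.
  by rewrite -scalerA -scalerDr mulrBr mulrA lerD2r pZ.
Qed.

(** Minimality gives [p y <= shift_sublinear p x y], and the term t = 1 of that infimum yields p(y)
    + p(x) <= p(y + x), the converse of subadditivity. Additivity makes p odd, which settles
    negative scalars. *)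
Lemma minimal_sublinear_linear (R : realType) (V : lmodType R) (p : V -> R) :
  minimal_sublinear p -> linear (p : V -> R^o).
Proof.
move=> [sp pmin]; have [pD _] := sp.
have pDE x y : p (x + y) = p x + p y.
  apply/eqP; rewrite eq_le pD/=.
  have /pmin/(_ _ y) : sublinear (shift_sublinear p x) by exact: sublinear_shift.
  have shift_le z : shift_sublinear p x z <= p z.
    have := shift_sublinear_le x z sp (lexx 0).
    by rewrite scale0r addr0 mul0r subr0.
  move=> /(_ shift_le) /le_trans /(_ (shift_sublinear_le x y sp ler01)).
  by rewrite scale1r mul1r addrC [x + y]addrC; lra.
have pN x : p (- x) = - p x.
  by apply/eqP; rewrite -addr_eq0 -pDE addNr (sublinear0 sp).
move=> a x y; rewrite pDE; congr (_ + _).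
have [a0|/ltW a0] := leP 0 a; first exact: sublinear_scale.
rewrite -[a]opprK scaleNr pN (sublinear_scale _ sp) ?oppr_ge0//.
by rewrite [RHS]scaleNr.
Qed.

(** The minimal functional f is taken below the shift of p by x rather than below p itself. The term
    t = 1 of the shift at -x is p(0) - p(x), so f(-x) <= -p(x), and this forces f to reach p at
    x. *)
Lemma hahn_banach_sublinear (R : realType) (V : lmodType R) (p : V -> R)
    (x : V) :
  sublinear p ->
  exists f : V -> R, [/\ linear (f : V -> R^o), forall y, f y <= p y
                       & p x <= f x].
Proof.
move=> sp; have [f fmin f_le] := exists_minimal_sublinear (sublinear_shift x sp).
have fl := minimal_sublinear_linear fmin; have [sf _] := fmin.
exists f; split=> // [y|].
- apply: le_trans (f_le y) _.
  have := shift_sublinear_le x y sp (lexx 0).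
  by rewrite scale0r addr0 mul0r subr0.
- have := le_trans (f_le (- x)) (shift_sublinear_le x (- x) sp ler01).
  rewrite scale1r addNr (sublinear0 sp) mul1r.
  by have := sublinear_ge x sf; lra.
Qed.

(** * Separation of a point from a subspace by a continuous functional *)

Lemma linear_functional0 (R : realType) (V : lmodType R) (f : V -> R) :
  linear (f : V -> R^o) -> f 0 = 0.
Proof.
move=> fl; have := fl 1 0 0; rewrite !scale1r addr0 => /eqP.
by rewrite -subr_eq0 opprD addrA subrr sub0r oppr_eq0 => /eqP.
Qed.

(** By linearity the one-sided bound also holds for -f, so f is 1-Lipschitz. *)
Lemma linear_le_norm_continuous_dual (R : realType) (V : normedModType R)
    (f : V -> R) :
  linear (f : V -> R^o) -> (forall x, f x <= `|x|) -> continuous_dual V f.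
Proof.
move=> fl f_le; split=> //.
have fB x y : f (x - y) = f x - f y.
  by rewrite addrC -scaleN1r fl [_ *: _]mulN1r addrC.
move=> x; apply/cvgrPdist_le => e e0; near=> y.
apply: (@le_trans _ _ `|x - y|); last first.
  by near: y; exact: cvgr_dist_le.
by rewrite ler_norml lerNl opprB -!fB f_le andbT distrC f_le.
Unshelve. all: by end_near. Qed.

(** Hahn-Banach is applied to the distance to [M]. This distance is at most the norm, which makes f
    continuous; it is 0 on [M], so f <= 0 there and f = 0 because [M] is stable under negation; it
    is at least [e] at [x], where f reaches it. *)
Lemma continuous_dual_separation (R : realType) (V : normedModType R)
    (M : set V) (x : V) (e : R) :
  M 0 -> (forall y z, M y -> M z -> M (y + z)) ->
  (forall a y, M y -> M (a *: y)) ->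
  0 < e -> (forall m, M m -> e <= `|x - m|) ->
  exists f : V -> R,
    [/\ continuous_dual V f, forall m, M m -> f m = 0 & 0 < f x].
Proof.
move=> M0 MD MZ e0 xM.
have lbM y : has_lbound [set `|y - m| | m in M].
  by exists 0 => _ [m _ <-].
have sp : sublinear (fun y => inf [set `|y - m| | m in M]).
  apply: (@sublinear_inf _ _ _ M (fun m y => `|y - m|)) => //.
  - by exists 0.
  - move=> m n y z Mm Mn; exists (m + n); first exact: MD.
    by rewrite opprD addrACA; exact: ler_normD.
  - move=> m a y a0 Mm; exists (a *: m); first exact: MZ.
    by rewrite -scalerBr normrZ ger0_norm.
have [f [fl f_le f_ge]] := hahn_banach_sublinear x sp.
have f_dist y m : M m -> f y <= `|y - m|.
  by move=> Mm; apply: le_trans (f_le y) _; apply: ge_inf => //; exists m.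
exists f; split.
- apply: linear_le_norm_continuous_dual => // y.
  by have := f_dist y _ M0; rewrite subr0.
- move=> m Mm; apply/le_anti/andP; split.
    by have := f_dist m m Mm; rewrite subrr normr0.
  have MNm : M (- m) by rewrite -scaleN1r; exact: MZ.
  have := f_dist (- m) _ MNm; rewrite subrr normr0.
  have := fl (-1) m 0; rewrite scaleN1r addr0.
  by rewrite (linear_functional0 fl) addr0 [_ *: _]mulN1r => ->; rewrite oppr_le0.
- apply: lt_le_trans f_ge; apply: lt_le_trans e0 _.
  apply: lb_le_inf; first by exists `|x - 0|, 0.
  by move=> _ [m Mm <-]; exact: xM.
Qed.

(** * Rational spans and a criterion for separability *)

(** Indexing by finite lists of pairs makes countability immediate, since [seq (rat * nat)] is a
    countable type, and turns sums into concatenations. *)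
Definition rat_span (R : realType) (V : lmodType R) (k : nat -> V) : set V :=
  range (fun s : seq (rat * nat) => \sum_(c <- s) ratr c.1 *: k c.2).

Lemma rat_span0 (R : realType) (V : lmodType R) (k : nat -> V) : rat_span k 0.
Proof. by exists [::] => //; rewrite big_nil. Qed.

Lemma rat_spanD (R : realType) (V : lmodType R) (k : nat -> V) (x y : V) :
  rat_span k x -> rat_span k y -> rat_span k (x + y).
Proof. by move=> [s _ <-] [t _ <-]; exists (s ++ t) => //; rewrite big_cat. Qed.

Lemma rat_spanZ (R : realType) (V : lmodType R) (k : nat -> V) (q : rat)
    (x : V) : rat_span k x -> rat_span k (ratr q *: x).
Proof.
move=> [s _ <-]; exists [seq (q * c.1, c.2) | c <- s] => //.
rewrite big_map scaler_sumr; apply: eq_bigr => c _.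
by rewrite scalerA rmorphM.
Qed.

Lemma rat_span_mem (R : realType) (V : lmodType R) (k : nat -> V) (n : nat) :
  rat_span k (k n).
Proof. by exists [:: (1, n)] => //; rewrite big_seq1 rmorph1 scale1r. Qed.

Lemma separable_total_sequence (R : realType) (V : normedModType R)
    (k : nat -> V) :
  (forall f, continuous_dual V f -> (forall n, f (k n) = 0) ->
    forall x, f x = 0) ->
  separable V.
Proof.
move=> ktotal; exists (rat_span k); split.
  exact: sub_countable (card_image_le _ _) (countableP _).
apply: contrapT => /denseNE[U [[x [oU Ux]] UD]].
have /nbhs_ballP[r /= r0 xrU] : nbhs x U by exact: open_nbhs_nbhs.
(* [M] is the closure of the rational span. Unlike the span itself it is stable under real scalars,
   so separation applies to it. *)
pose M := [set y : V | forall e, 0 < e -> exists2 d, rat_span k d & `|y - d| < e].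
have DM d : rat_span k d -> M d.
  by move=> Dd e e0; exists d => //; rewrite subrr normr0.
have MD y z : M y -> M z -> M (y + z).
  move=> My Mz e e0; have e20 : 0 < e / 2 by rewrite divr_gt0.
  have [[c Dc yc] [d Dd zd]] := (My _ e20, Mz _ e20).
  exists (c + d); first exact: rat_spanD.
  rewrite opprD addrACA (splitr e); apply: le_lt_trans (ler_normD _ _) _.
  exact: ltrD.
(* First d is chosen close to y in terms of |a|, then a rational q close to a in terms of |d|; each
   error is below e / 2. Adding 1 to |a| and |d| keeps the denominators positive. *)
have MZ a y : M y -> M (a *: y).
  move=> My e e0; have e20 : 0 < e / 2 by rewrite divr_gt0.
  have a1 : 0 < `|a| + 1 by rewrite ltr_wpDl.
  have [d Dd yd] := My _ (divr_gt0 e20 a1).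
  have d1 : 0 < `|d| + 1 by rewrite ltr_wpDl.
  have ed0 : 0 < e / 2 / (`|d| + 1) by rewrite divr_gt0.
  have [|q] := @rat_in_itvoo R (a - e / 2 / (`|d| + 1)) (a + e / 2 / (`|d| + 1)).
    by lra.
  rewrite in_itv/= => /andP[q1 q2].
  exists (ratr q *: d); first exact: rat_spanZ.
  have -> : a *: y - ratr q *: d = a *: (y - d) + (a - ratr q) *: d.
    by rewrite scalerBr scalerBl addrA subrK.
  rewrite (splitr e); apply: le_lt_trans (ler_normD _ _) _; rewrite !normrZ.
  apply: ltrD.
    apply: (@le_lt_trans _ _ ((`|a| + 1) * `|y - d|)).
      by rewrite ler_wpM2r// lerDl.
    by rewrite mulrC -ltr_pdivlMr.
  apply: (@le_lt_trans _ _ (`|a - ratr q| * (`|d| + 1))).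
    by rewrite ler_wpM2l// lerDl.
  by rewrite -ltr_pdivlMr// ltr_norml; apply/andP; split; lra.
have r20 : 0 < r / 2 by rewrite divr_gt0.
(* If m in [M] were within r / 2 of x, a point of the rational span within r / 2 of m would lie in
   the ball of radius r around x, hence in [U]. *)
have xM m : M m -> r / 2 <= `|x - m|.
  move=> Mm; rewrite leNgt; apply/negP => xm.
  have [d Dd md] := Mm _ r20.
  suff : (U `&` rat_span k) d by rewrite UD.
  split=> //; apply: xrU; rewrite -ball_normE /=.
  rewrite (splitr r) -[x](subrK m) -addrA.
  by apply: le_lt_trans (ler_normD _ _) _; exact: ltrD.
have [f [fd f0 fx]] :=
  continuous_dual_separation (DM _ (rat_span0 k)) MD MZ r20 xM.
have := ktotal f fd (fun n => f0 _ (DM _ (rat_span_mem k n))) x.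
by move=> fx0; rewrite fx0 ltxx in fx.
Qed.

Theorem proposition2p11 (R : realType)
    (Omega Omega' : ptopologicalType)
    (lcO : locally_compact [set: Omega]) (hO : hausdorff_space Omega)
    (lcO' : locally_compact [set: Omega']) (hO' : hausdorff_space Omega')
    (mu : {measure set (borel Omega) -> \bar R})
    (mu_reg : regular_borel_measure mu)
    (mu' : {measure set (borel Omega') -> \bar R})
    (mu'_reg : regular_borel_measure mu')
    (K : Omega * Omega' -> R)
    (B : completeNormedModType R) (evB : B -> Omega -> R)
    (F : normedModType R) (evF : F -> Omega' -> R)
    (phi : F -> B -> R)
    (rkbsB : left_rkbs K evB evF phi)
    (X' : set Omega') (cX' : countable X')
    (X'P : forall g : F, (forall y, X' y -> evF g y = 0) <-> g = 0) :
  separable B.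
Proof.
have [_ _ _ [phil [_ _ phi_surj] _] Kmem repr] := rkbsB.
have /choice[ker kerE] : forall y, exists k : B, evB k = fun x => K (x, y).
  by move=> y; have [k _ <-] := Kmem y; exists k.
(* A countable set is empty or an image of [nat]; if X' is empty, the zero sequence serves as a
   default. *)
have [k kX'] : exists k : nat -> B, forall y, X' y -> exists n, k n = ker y.
  have [X0|[h]] := pfcard_geP cX'.
    by exists (fun=> 0) => y; rewrite X0.
  exists (ker \o h) => y /(@surj _ _ _ _ h)[n _ <-].
  by exists n.
apply: (separable_total_sequence (k := k)) => f fd fk x.
have [g _ gf] := phi_surj f fd.
have g0 : g = 0.
  apply/X'P => y /kX'[n kn].
  by rewrite -(repr y (ker y) (kerE y)) gf -kn fk.
by rewrite -gf g0 (linear_functional0 (f := phi^~ x))// => a u v; rewrite phil.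
Qed.
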